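(* For every integer $d \geq 3$ there exists at least one proper polynomial map $f \colon \mathbb{C}^2 \to \mathbb{C}^2$ of topological degree $d$ such that $f$ is not equivalent to any map of the form $(x, y) \mapsto (x, Q(x,y))$ with $Q \in \mathbb{C}[x,y]$.
   Context: A dominant polynomial map $f \colon \mathbb{C}^2 \to \mathbb{C}^2$ is proper if it is closed and $f^{-1}(p)$ is compact for every $p \in \mathbb{C}^2$; equivalently, if the preimage of every compact set is compact. Its topological degree is the number of preimages of a general point. $\mathrm{Aut}(\mathbb{C}^2)$ denotes the group of polynomial automorphisms of $\mathbb{C}^2$. Two proper polynomial maps $f_1, f_2 \colon \mathbb{C}^2 \to \mathbb{C}^2$ are equivalent if there exist $\Phi_1, \Phi_2 \in \mathrm{Aut}(\mathbb{C}^2)$ such that $f_2 = \Phi_2 \circ f_1 \circ \Phi_1$. *)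

(* Defs.v *)
From HB Require Import structures.
From mathcomp Require Import all_boot all_order all_algebra.
From mathcomp Require Import complex polyXY.
From mathcomp Require Import all_classical all_reals topology normedtype.
Import Order.TTheory GRing.Theory Num.Theory.
Import numFieldNormedType.Exports.

Set Implicit Arguments.
Unset Strict Implicit.
Unset Printing Implicit Defensive.

Local Open Scope classical_set_scope.
Local Open Scope ring_scope.

(* The definitions are stated over a numClosedFieldType K, whose topology is   *)
(* the one induced by its norm, and are meant to be used with K := R[i] for R  *)
(* a realType. On K * K, [closed] and [compact] refer to the product topology, *)
(* i.e. the Euclidean one when K = R[i]. A polynomial in the two variables     *)
(* (x, y) is an element P of {poly {poly K}}, evaluated by P.[x, y].           *)

Section PolynomialSelfMaps.
Variable K : numClosedFieldType.
Implicit Types (f g : K * K -> K * K) (A : set (K * K)).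

Definition polynomial_map f : Prop :=
  exists P Q : {poly {poly K}},
    forall z, f z = (P.[z.1, z.2], Q.[z.1, z.2]).

Definition zariski_closed A : Prop :=
  exists S : set {poly {poly K}},
    A = [set z | forall P, S P -> P.[z.1, z.2] = 0].

Definition dominant f : Prop :=
  forall A, zariski_closed A -> range f `<=` A -> A = setT.

Definition closed_map f : Prop :=
  forall A, closed A -> closed (f @` A).

Definition proper_polynomial_map f : Prop :=
  [/\ polynomial_map f, dominant f, closed_map f &
      forall p, compact (f @^-1` [set p])].

(* "A general point" is a point outside some proper Zariski closed subset Z.   *)
Definition has_topological_degree f (d : nat) : Prop :=
  exists Z : set (K * K),
    [/\ zariski_closed Z, Z <> setT &
        forall p, ~ Z p -> (f @^-1` [set p] #= `I_d)%card].

Definition polynomial_automorphism f : Prop :=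
  polynomial_map f /\
  exists g, [/\ polynomial_map g, cancel f g & cancel g f].

Definition equivalent_maps (f1 f2 : K * K -> K * K) : Prop :=
  exists Phi1 Phi2 : K * K -> K * K,
    [/\ polynomial_automorphism Phi1, polynomial_automorphism Phi2 &
        f2 = Phi2 \o f1 \o Phi1].

End PolynomialSelfMaps.

(* Main.v *)
(* For d = m + 3 take f(x, y) = (x + y + xy, x^(m+2) y). On the fibre over     *)
(* (s, t), x is a root of chi = X^(m+3) - s X^(m+2) + t X + t and y is a       *)
(* polynomial in x, s, t; moreover chi'(x) is the Jacobian                     *)
(* J = x^(m+1) k with k = x - (m+2) y - (m+1) xy. Hence f is surjective, its   *)
(* properness is the continuity of the roots of chi, and a fibre without       *)
(* critical point has exactly d points.                                        *)
(*   Suppose f \o Phi = Psi \o g with g = (x, Q(x, y)) and Phi, Psi            *)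
(* automorphisms. Counting the fibres of g shows that Q(a, .) has degree d for *)
(* every a, so Q has a constant leading coefficient in y. By the chain rule    *)
(* J \o Phi is a nonzero constant times dQ/dy. Comparing degrees in y, k \o Phi *)
(* has degree 1 in y with a constant leading coefficient, so its zero set is   *)
(* the graph of a polynomial and maps onto the curve k = 0. But that           *)
(* curve is parametrized by x != -(m+2)/(m+1), so it has no nonconstant        *)
(* polynomial parametrization.                                                 *)
Require Import Defs.
From HB Require Import structures.
From mathcomp Require Import all_boot all_order all_algebra.
From mathcomp Require Import complex polyXY separable.
From mathcomp Require Import all_classical all_reals topology normedtype.
From mathcomp Require Import ring zify.
Import Order.TTheory GRing.Theory Num.Theory.
Import numFieldNormedType.Exports.
Set Implicit Arguments.
Unset Strict Implicit.
Unset Printing Implicit Defensive.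
Local Open Scope ring_scope.

(** * Substitution and Jacobians of bivariate polynomials *)

(** Eliminating y from x + y + xy = s and x^(m+2) y = t gives [chi]; since x + 1 and x^(m+2) are
    coprime, y is recovered polynomially from x, s, t ([dmap_fiber]). The fibres of [dmap] are thus
    root sets of a monic polynomial: nonempty, finite, varying continuously ([near_fiber], whence
    [closed_dmap]), and of size m + 3 off the discriminant ([topological_degree_dmap]).

    An equivalence with (x, Q) identifies the fibres of Q(a, .) with fibres of [dmap]. Counting them
    ([size_of_fibers], [constant_fiber_size]) shows that Q has degree m + 3 in y with constant
    leading coefficient. By the chain rule [jac_subst], the Jacobian x^(m+1) k of [dmap] pulls back
    to a nonzero constant times dQ/dy, of degree m + 2 in y. The factor x^(m+1) takes at least m + 1
    of it, so the pullback of k is linear in y and vanishes on the graph of a polynomial. The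
    automorphism would embed that graph in the curve k = 0, that is (m+2 + (m+1)x)(1 - (m+1)y) =
    m+2, a hyperbola, on which every polynomial curve is constant. *)

Section Substitution.
Variable K : fieldType.
Implicit Types (p : {poly K}) (u v A B : {poly {poly K}}).

(** Here the inner variable stands for x and the outer one for y, the reverse of [polynomial_map],
    so that [size] measures the degree in y; [swapXY] converts. *)
Definition subst_coef A : {poly K} -> {poly {poly K}} :=
  horner_morph (f := polyC \o polyC) (u := A) (fun _ => mulrC _ _).
HB.instance Definition _ A := GRing.RMorphism.on (subst_coef A).

Definition subst A B : {poly {poly K}} -> {poly {poly K}} :=
  horner_morph (f := subst_coef A) (u := B) (fun _ => mulrC _ _).
HB.instance Definition _ A B := GRing.RMorphism.on (subst A B).

Lemma subst_coefC A c : subst_coef A c%:P = c%:P%:P.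
Proof. exact: horner_morphC. Qed.
Lemma subst_coefX A : subst_coef A 'X = A.
Proof. exact: horner_morphX. Qed.
Lemma substC A B p : subst A B p%:P = subst_coef A p.
Proof. exact: horner_morphC. Qed.
Lemma substX A B : subst A B 'X = B.
Proof. exact: horner_morphX. Qed.

Lemma horner_subst A B u y x :
  (subst A B u).[y, x] = u.[B.[y, x], A.[y, x]].
Proof.
elim/poly_ind: u => [|u p IH]; first by rewrite rmorph0 !horner0.
rewrite rmorphD rmorphM /= substX substC !hornerE IH; congr (_ + _).
elim/poly_ind: p => [|p c IHp]; first by rewrite rmorph0 !horner0.
by rewrite rmorphD rmorphM /= subst_coefX subst_coefC !hornerE IHp.
Qed.

Definition dX u : {poly {poly K}} := map_poly (@deriv K) u.

Lemma dX_coef u i : (dX u)`_i = (u`_i)^`().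
Proof. by rewrite coef_map_id0 ?deriv0. Qed.

Lemma dX_is_zmod : zmod_morphism dX.
Proof.
by move=> u v; apply/polyP => i; rewrite dX_coef !coefB !dX_coef derivB.
Qed.
HB.instance Definition _ :=
  GRing.isZmodMorphism.Build {poly {poly K}} {poly {poly K}} dX dX_is_zmod.

Lemma dXM u v : dX (u * v) = dX u * v + u * dX v.
Proof.
apply/polyP => i; rewrite coefD dX_coef !coefM raddf_sum -big_split /=.
by apply: eq_bigr => j _; rewrite !dX_coef derivM.
Qed.

Lemma dXC p : dX p%:P = p^`()%:P.
Proof. by apply/polyP => i; rewrite dX_coef !coefC; case: ifP; rewrite ?deriv0. Qed.

Lemma dX_X : dX 'X = 0.
Proof.
apply/polyP => i; rewrite dX_coef coefX coef0.
by case: (i == _)%N; rewrite ?deriv0 -?polyC1 ?derivC.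
Qed.

(** An arbitrary derivation trivial on [K], so that one induction yields the chain rule for both
    partial derivatives. *)
Lemma derivation_subst (D : {additive {poly {poly K}} -> {poly {poly K}}})
    (DM : forall u v, D (u * v) = D u * v + u * D v)
    (DC : forall c, D c%:P%:P = 0) A B u :
  D (subst A B u) =
  subst A B (dX u) * D A + subst A B u^`() * D B.
Proof.
elim/poly_ind: u => [|u p IH].
  by rewrite deriv0 (raddf0 dX) !rmorph0 !mul0r addr0 raddf0.
have Dp : D (subst_coef A p) = subst_coef A p^`() * D A.
  elim/poly_ind: p => [|p c IHp]; first by rewrite deriv0 !rmorph0 mul0r raddf0.
  rewrite derivMXaddC !rmorphD !rmorphM /= !subst_coefX subst_coefC.
  by rewrite raddfD /= DM DC IHp addr0; ring.
rewrite (raddfD dX) /= dXM dX_X dXC mulr0 addr0 derivMXaddC.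
rewrite !rmorphD !rmorphM /= !substX !substC.
by rewrite raddfD /= DM IH Dp; ring.
Qed.

Definition jac A B := dX A * B^`() - A^`() * dX B.

Lemma jac_subst A B u v :
  jac (subst A B u) (subst A B v) = subst A B (jac u v) * jac A B.
Proof.
have ddX w : dX (subst A B w) = subst A B (dX w) * dX A + subst A B w^`() * dX B.
  by apply: (@derivation_subst dX) => [|c]; [exact: dXM|rewrite /= dXC derivC].
have ddY w :
    (subst A B w)^`() = subst A B (dX w) * A^`() + subst A B w^`() * B^`().
  by apply: (@derivation_subst (@deriv {poly K})) => [|c]; [exact: derivM|rewrite /= derivC].
rewrite /jac !ddX !ddY rmorphB !rmorphM /=; ring.
Qed.

End Substitution.

(** * Polynomials in characteristic zero and over closed fields *)

Lemma size_deriv_pchar0 (R : idomainType) (R0 : forall n, n.+1%:R != 0 :> R)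
  (p : {poly R}) : size p^`() = (size p).-1.
Proof.
case sp: (size p) => [|[|n]].
- by move/eqP: sp; rewrite size_poly_eq0 => /eqP->; rewrite deriv0 size_poly0.
- by rewrite [p]size1_polyC ?sp// derivC size_poly0.
apply/anti_leq; rewrite -ltnS -sp lt_size_deriv -?size_poly_gt0 ?sp//=.
apply: contraT; rewrite -leqNgt => /leq_sizeP/(_ n (leqnn n))/eqP.
rewrite coef_deriv -mulr_natr mulf_eq0 (negPf (R0 _)) orbF.
have -> : p`_n.+1 = lead_coef p by rewrite lead_coefE sp.
by rewrite lead_coef_eq0 -size_poly_eq0 sp.
Qed.

Section ClosedFieldPolynomials.
Variable K : numClosedFieldType.
Implicit Types (p q : {poly K}) (u v : {poly {poly K}}).

Lemma poly_vanishing p : (forall x, p.[x] = 0) -> p = 0.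
Proof.
move=> p0; apply/eqP; apply: contraT => /max_poly_roots.
move=> /(_ [seq i%:R | i <- iota 0 (size p)]).
rewrite size_map size_iota ltnn; apply.
  by apply/allP => x _; rewrite /root p0.
by rewrite map_inj_uniq ?iota_uniq// => i j /eqP; rewrite eqr_nat => /eqP.
Qed.

Lemma exists_nonroot p : p != 0 -> exists x, p.[x] != 0.
Proof.
move=> p0; apply: contrapT => H; move/eqP: p0; apply.
apply: poly_vanishing => x; apply/eqP; apply: contraT => px.
by case: H; exists x.
Qed.

Lemma exists_notin (s : seq K) : exists x, x \notin s.
Proof.
have [|x] := @exists_nonroot (\prod_(z <- s) ('X - z%:P)).
  by rewrite monic_neq0 ?monic_prod_XsubC.
by rewrite -rootE root_prod_XsubC; exists x.
Qed.

Lemma horner_fiber u x y : (map_poly (horner_eval x) u).[y] = u.[y, x].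
Proof. by rewrite -{1}(hornerC y x) -[_.[x]]/(horner_eval x _) horner_map. Qed.

Lemma horner2_inj u v : (forall x y, u.[y, x] = v.[y, x]) -> u = v.
Proof.
move=> uv; apply/subr0_eq/polyP => i; rewrite coef0; apply: poly_vanishing => x.
rewrite -[_.[x]]/(horner_eval x _) -coef_map.
suff -> : map_poly (horner_eval x) (u - v) = 0 by rewrite coef0.
by apply: poly_vanishing => y; rewrite horner_fiber !hornerE uv subrr.
Qed.

Lemma simple_roots p : p != 0 -> (forall x, root p x -> p^`().[x] != 0) ->
  exists r : seq K, [/\ uniq r, size r = (size p).-1 & root p =1 mem r].
Proof.
move=> p0 simple; have [r Dp] := closed_field_poly_normal p.
have lp0 : lead_coef p != 0 by rewrite lead_coef_eq0.
exists r; split.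
- rewrite -(separable_prod_XsubC r).
  apply: (@dvdp_separable K p); first by rewrite [p in _ %| p]Dp dvdpZr.
  by rewrite unlock; apply/Pdiv.ClosedField.coprimepP.
- by rewrite Dp size_scale// size_prod_XsubC.
- by move=> x; rewrite Dp rootZ// root_prod_XsubC.
Qed.

(** A root a of the leading coefficient would lower the degree of the fibre over a; over a closed
    field, having no root means being a nonzero constant. *)
Lemma constant_fiber_size u n : (forall a, size (map_poly (horner_eval a) u) = n.+1) ->
  size u = n.+1 /\ lead_coef u \is a GRing.unit.
Proof.
move=> sz.
have u0 : u != 0.
  by apply/eqP => u0; move: (sz 0); rewrite u0 rmorph0 size_poly0.
have lu0 : lead_coef u != 0 by rewrite lead_coef_eq0.
have su : size u = n.+1.
  have [a la] := exists_nonroot lu0.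
  by rewrite -(sz a) size_map_poly_id0.
split=> //; rewrite poly_unitE.
have lc_nz a : (lead_coef u).[a] != 0.
  apply/eqP => la; have := sz a; suff : (size (map_poly (horner_eval a) u) <= n)%N.
    by move=> le eq; rewrite eq ltnn in le.
  apply/leq_sizeP => j; rewrite leq_eqVlt coef_map /= => /predU1P[<-|nj].
    by rewrite /horner_eval -la lead_coefE su.
  by rewrite nth_default ?rmorph0// su.
have s1 : size (lead_coef u) == 1.
  apply: contraT => /closed_rootP[a]; rewrite rootE => /eqP la.
  by have := lc_nz a; rewrite la eqxx.
by rewrite s1 -horner_coef0 unitfE lc_nz.
Qed.

End ClosedFieldPolynomials.

(** * The map and its fibres *)

Section FiberPolynomial.
Variables (R : comNzRingType) (m : nat).
Implicit Type p : R * R.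

Definition chi p : {poly R} :=
  'X^(m.+2) * ('X - p.1%:P) + p.2%:P * ('X + 1%:P).

Lemma horner_chi p x : (chi p).[x] = x ^+ m.+2 * (x - p.1) + p.2 * (x + 1).
Proof. by rewrite /chi !hornerE. Qed.

Lemma size_chi_tail p : (size (p.2%:P * ('X + 1%:P))%R < m.+4)%N.
Proof.
apply: (leq_ltn_trans (size_polyMleq _ _)).
rewrite size_XaddC size_polyC; case: (_ != 0) => //=.
Qed.

Lemma size_chi_head p : size ('X^(m.+2) * ('X - p.1%:P)) = m.+4.
Proof.
by rewrite size_monicM ?monicXn ?polyXsubC_eq0// size_polyXn size_XsubC addn2.
Qed.

Lemma chi_monic p : chi p \is monic.
Proof.
rewrite monicE /chi lead_coefDl; last by rewrite size_chi_head size_chi_tail.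
by rewrite -monicE monicMl ?monicXn ?monicXsubC.
Qed.

Lemma size_chi p : size (chi p) = m.+4.
Proof. by rewrite /chi size_polyDl size_chi_head// size_chi_tail. Qed.

Lemma horner_deriv_chi p x :
  (chi p)^`().[x] = m.+2%:R * x ^+ m.+1 * (x - p.1) + x ^+ m.+2 + p.2.
Proof.
rewrite /chi derivD derivM derivM derivXn derivB derivD derivX !derivC.
rewrite !(hornerMn, hornerXn, hornerD, hornerM, hornerN, hornerC, hornerX).
by rewrite -mulr_natl -[m.+2.-1]/m.+1; ring.
Qed.

End FiberPolynomial.

Lemma map_chi (R R' : comNzRingType) (f : {rmorphism R -> R'}) m p :
  map_poly f (chi m p) = chi m (f p.1, f p.2).
Proof.
rewrite /chi rmorphD rmorphM rmorphM rmorphB rmorphD /= map_polyXn map_polyX.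
by rewrite !map_polyC /= rmorph1.
Qed.

Section Map.
Variables (K : numClosedFieldType) (m : nat).
Implicit Types (z p : K * K) (x : K).

Definition dmap z : K * K := (z.1 + z.2 + z.1 * z.2, z.1 ^+ m.+2 * z.2).

(** The factor of the Jacobian determinant of [dmap] other than x^(m+1). *)
Definition crit z : K := z.1 - m.+2%:R * z.2 - m.+1%:R * (z.1 * z.2).

(** Obtained from (x + 1) y = s - x and x^(m+2) y = t through the Bezout relation [geometric]
    between x + 1 and x^(m+2). *)
Definition snd_coord p x : K :=
  (-1) ^+ m * (p.2 - (p.1 - x) * \sum_(i < m.+2) x ^+ (m.+1 - i) * (-1) ^+ i).

Lemma geometric x : (x + 1) * \sum_(i < m.+2) x ^+ (m.+1 - i) * (-1) ^+ i =
  x ^+ m.+2 - (-1) ^+ m.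
Proof.
have -> : x + 1 = x - (-1) by rewrite opprK.
by rewrite -(subrXX x (-1) m.+2) -[in (-1) ^+ m.+2]addn2 exprD sqrrN expr1n mulr1.
Qed.

Lemma dmap_fiber z p :
  dmap z = p <-> root (chi m p) z.1 /\ z.2 = snd_coord p z.1.
Proof.
case: z p => x y [s t] /=; rewrite /snd_coord rootE horner_chi /=.
have := geometric x; set G := \sum_(i < _) _ => HG.
have e1 : (-1) ^+ m * (-1) ^+ m = 1 :> K by rewrite -exprMn mulrNN mulr1 expr1n.
set e := (-1) ^+ m in HG e1 *; rewrite /dmap /=.
split=> [[<- <-]|[/eqP r ->]]; first split.
- by apply/eqP; ring.
- transitivity (e * (y * (x ^+ m.+2 - (x + 1) * G))); last by ring.
  by rewrite HG -[LHS]mul1r -e1; ring.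
- have r' : t * (x + 1) = x ^+ m.+2 * (s - x) by apply/subr0_eq; rewrite -r; ring.
  congr pair.
    transitivity (x + e * (t * (x + 1) - (s - x) * ((x + 1) * G))); first by ring.
    by rewrite HG r' -[s in RHS](subrKC x) -[s - x in RHS]mul1r -e1; ring.
  transitivity (e * (x ^+ m.+2 * t - x ^+ m.+2 * (s - x) * G)); first by ring.
  rewrite -r'; transitivity (e * t * (x ^+ m.+2 - (x + 1) * G)); first by ring.
  by rewrite HG -[RHS]mulr1 -e1; ring.
Qed.

Lemma deriv_chi z : (chi m (dmap z))^`().[z.1] = z.1 ^+ m.+1 * crit z.
Proof.
rewrite horner_deriv_chi /crit (_ : (dmap z).1 = z.1 + z.2 + z.1 * z.2)//.
by rewrite (_ : (dmap z).2 = z.1 ^+ m.+2 * z.2)//; rewrite (exprS _ m.+1) -(natr1 m.+1); ring.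
Qed.

Lemma dmap_inj_fst p z z' : dmap z = p -> dmap z' = p -> z.1 = z'.1 -> z = z'.
Proof.
move=> /dmap_fiber[_ e] /dmap_fiber[_ e'] eq1.
by rewrite [z]surjective_pairing [z']surjective_pairing e e' eq1.
Qed.

Lemma dmap_surj p : exists z, dmap z = p.
Proof.
have /closed_rootP[x rx] : size (chi m p) != 1 by rewrite size_chi.
by exists (x, snd_coord p x); apply/dmap_fiber.
Qed.

(* The fibres of [q] are embedded by [h] in fibres of [dmap], which have at    *)
(* most [m.+3] points; a general one has [m.+3] simple points.                 *)
Lemma size_of_fibers (q : {poly K}) (c h : K -> K * K) :
    (forall y, dmap (h y) = c q.[y]) -> injective h ->
    (forall b z, dmap z = c b -> exists2 y, h y = z & q.[y] = b) ->
    (forall y, (h y).1 ^+ m.+1 * crit (h y) = 0 -> q^`().[y] = 0) ->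
  size q = m.+4.
Proof.
move=> hc h_inj h_surj hcrit.
have fstI b y y' : q.[y] = b -> q.[y'] = b -> (h y).1 = (h y').1 -> y = y'.
  move=> qy qy' e; apply: h_inj; apply: (@dmap_inj_fst (c b)) => //.
  - by rewrite hc qy.
  - by rewrite hc qy'.
have rchi b y : q.[y] = b -> root (chi m (c b)) (h y).1.
  by move=> qy; have /dmap_fiber[] := hc y; rewrite qy.
have bound b (s : seq K) : uniq s -> all (fun y => q.[y] == b) s -> (size s < m.+4)%N.
  move=> us /allP sb.
  rewrite -(size_chi m (c b)) -(size_map (fun y => (h y).1)).
  apply: max_poly_roots; first exact/monic_neq0/chi_monic.
    by apply/allP => _ /mapP[y /sb/eqP qy ->]; apply: rchi.
  rewrite map_inj_in_uniq// => y y' /sb/eqP qy /sb/eqP qy'; exact: fstI qy qy'.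
have dq0 : q^`() != 0.
  apply/eqP => dq0; suff q_const y : q.[y] = q.[0].
    have := bound q.[0] [seq i%:R | i <- iota 0 m.+4].
    rewrite size_map size_iota ltnn => absurd; apply: notF; apply: absurd.
      by rewrite map_inj_uniq ?iota_uniq// => i j /eqP; rewrite eqr_nat => /eqP.
    by apply/allP => y _; rewrite q_const.
  have : (size q <= 1)%N.
    have := size_deriv_pchar0 (fun n => lt0r_neq0 (ltr0Sn K n)) q.
    by rewrite dq0 size_poly0; case: (size q) => [|[|]].
  by move=> /size1_polyC ->; rewrite !hornerC.
have [r Dr] := closed_field_poly_normal q^`().
(* A value b that is not critical for [q]: [q - b] and [chi] at [c b] then both have only simple
   roots, and [h] matches them. *)
have [b b_r] := exists_notin [seq q.[y] | y <- r].
have lead0 : lead_coef q^`() != 0 by rewrite lead_coef_eq0.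
have regular y : q.[y] = b -> q^`().[y] != 0.
  move=> qy; apply: contra b_r => ry; apply/mapP; exists y => //.
  by rewrite -root_prod_XsubC -(rootZ _ _ lead0) -Dr.
have size_q : (1 < size q)%N.
  by rewrite ltnNge; apply: contra dq0 => /size1_polyC->; rewrite derivC.
have size_qb : size (q - b%:P) = size q.
  by rewrite size_polyDl// size_polyN (leq_ltn_trans (size_polyC_leq1 _)).
have [||rs [urs srs Drs]] := @simple_roots _ (q - b%:P).
- by rewrite -size_poly_gt0 size_qb ltnW.
- by move=> y; rewrite rootE !hornerE subr_eq0 derivB derivC subr0 => /eqP/regular.
have [||xs [uxs sxs Dxs]] := @simple_roots _ (chi m (c b)).
- exact/monic_neq0/chi_monic.
- move=> x rx; have /h_surj[y hy qy] : dmap (x, snd_coord (c b) x) = c b.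
    by apply/dmap_fiber.
  apply: contra (regular y qy) => /eqP cx; apply/eqP/hcrit.
  by rewrite -deriv_chi hc qy hy.
have rsE y : (y \in rs) = (q.[y] == b).
  by rewrite -[y \in rs]Drs rootE !hornerE subr_eq0.
have le1 : (size rs < m.+4)%N.
  by apply: (bound b) => //; apply/allP => y; rewrite rsE.
have le2 : (size xs <= size rs)%N.
  rewrite -(size_map (fun y => (h y).1) rs); apply: uniq_leq_size => // x xxs.
  have /h_surj[y hy qy] : dmap (x, snd_coord (c b) x) = c b.
    by apply/dmap_fiber; rewrite [root _ _]Dxs.
  by apply/mapP; exists y; rewrite ?rsE ?qy// hy.
rewrite size_chi in sxs; rewrite sxs in le2.
move: srs le1 le2; rewrite size_qb; lia.
Qed.

End Map.

(** * Properness and topological degree *)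

Local Open Scope classical_set_scope.

Lemma cvg_horner (K : numFieldType) (T : Type) (F : set_system T) (f : T -> K)
    (a : K) (q : {poly K}) : Filter F ->
  f @ F --> a -> q.[f w] @[w --> F] --> q.[a].
Proof.
move=> FF fa; elim/poly_ind: q => [|q c IH].
  by under eq_fun do rewrite horner0; rewrite horner0; exact: cvg_cst.
under eq_fun do rewrite hornerMXaddC.
by rewrite hornerMXaddC; apply: cvgD; [exact: cvgM|exact: cvg_cst].
Qed.

Section Proper.
Variables (K : numClosedFieldType) (m : nat).
Implicit Types (z p : K * K) (x : K).

Lemma polynomial_dmap : polynomial_map (@dmap K m).
Proof.
exists ('X + 'Y + 'X * 'Y), ('X ^+ m.+2 * 'Y) => z.
by rewrite /dmap !(horner_exp, hornerE).
Qed.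

Lemma dominant_dmap : dominant (@dmap K m).
Proof.
move=> A _ fA; apply/seteqP; split=> // p _; apply: fA.
by have [z <-] := dmap_surj m p; exists z.
Qed.

Lemma simple_fiber_card p :
    (forall x, root (chi m p) x -> (chi m p)^`().[x] != 0) ->
  (@dmap K m @^-1` [set p] #= `I_m.+3)%card.
Proof.
move=> simple; have [|r [ur sr Dr]] := simple_roots _ simple.
  exact/monic_neq0/chi_monic.
rewrite size_chi /= in sr.
pose g i := (r`_i, snd_coord m p r`_i).
have -> : @dmap K m @^-1` [set p] = g @` `I_m.+3.
  apply/seteqP; split=> [[x y] /dmap_fiber[/= rx ->]|_ [i /= im <-]].
    rewrite [root _ _]Dr inE in rx; exists (index x r).
      by rewrite /= -sr index_mem.
    by rewrite /g nth_index.
  by apply/dmap_fiber; split=> //=; rewrite [root _ _]Dr; apply: mem_nth; rewrite sr.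
apply: inj_card_eq => i j; rewrite !inE /= => im jm [/eqP + _].
by rewrite nth_uniq ?sr// => /eqP.
Qed.

Lemma dmap_fiber_compact p : compact (@dmap K m @^-1` [set p]).
Proof.
apply: finite_compact.
have [r Dr] := closed_field_poly_normal (chi m p).
apply: (sub_finite_set _ (finite_seq [seq (x, snd_coord m p x) | x <- r])).
move=> [x y] /dmap_fiber[/= rx ->]; apply/mapP; exists x => //.
by move: rx; rewrite Dr (monicP (chi_monic _ _)) scale1r root_prod_XsubC.
Qed.

(** * Topological degree through the discriminant *)

Definition chi_disc : {poly {poly K}} :=
  let c := chi m ('X, 'Y) in resultant c c^`().

(** The resultant commutes with specialization because the leading coefficients, 1 for [chi] and m +
    3 for its derivative, do not vanish. *)
Lemma horner_chi_disc p :
  chi_disc.[p.1, p.2] = resultant (chi m p) (chi m p)^`().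
Proof.
pose ev : {rmorphism {poly {poly K}} -> K} :=
  GRing.RMorphism.clone _ _ (horner_eval p.2 \o horner_eval p.1%:P) _.
rewrite -[LHS]/(ev chi_disc) /chi_disc.
set c := chi m _.
have c_monic : c \is monic := chi_monic m _.
have ev_c : map_poly ev c = chi m p.
  by rewrite map_chi /ev /= /horner_eval !hornerE -surjective_pairing.
have natP n : n.+1%:R != 0 :> {poly {poly K}}.
  by rewrite -!polyC_natr !polyC_eq0 pnatr_eq0.
rewrite map_resultant; first by rewrite -deriv_map ev_c.
  by rewrite (monicP c_monic) rmorph1 oner_neq0.
rewrite lead_coefE size_deriv_pchar0// size_chi coef_deriv.
have -> : c`_(m.+4.-1.-1).+1 = 1.
  by rewrite -(monicP c_monic) lead_coefE size_chi.
by rewrite rmorphMn rmorph1 pnatr_eq0.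
Qed.

Lemma chi_disc_simple p x : chi_disc.[p.1, p.2] != 0 ->
  root (chi m p) x -> (chi m p)^`().[x] != 0.
Proof.
rewrite horner_chi_disc resultant_eq0 -leqNgt => sg.
apply: contraTneq => dx; apply: contraTN sg => rx; rewrite -ltnNge.
have : root (gcdp (chi m p) (chi m p)^`()) x.
  by rewrite root_gcd rx /root dx eqxx.
apply: root_size_gt1.
by rewrite gcdp_eq0 negb_and monic_neq0 ?chi_monic.
Qed.

(** A double root of X^(m+3) + X + 1 satisfies (m+3) x^(m+2) = -1, hence (m+2) x = -(m+3). The
    second forces |x| >= 1, against the first. *)
Lemma chi_disc_neq0 : chi_disc.[0, 1] != 0.
Proof.
have /= -> := horner_chi_disc (0, 1); rewrite resultant_eq0 -leqNgt.
have : coprimep (chi m ((0, 1) : K * K)) (chi m (0, 1))^`().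
  apply/Pdiv.ClosedField.coprimepP => x.
  rewrite rootE horner_chi horner_deriv_chi /= subr0 mul1r => /eqP e1.
  apply/eqP => e2.
  have xm2 : m.+3%:R * x ^+ m.+2 = -1.
    by apply/subr0_eq; rewrite -[RHS]e2 -(natr1 m.+2) (exprS x m.+1); ring.
  have xE : m.+2%:R * x = - m.+3%:R.
    have : m.+3%:R * (x ^+ m.+2 * x + (x + 1)) = 0 by rewrite e1 mulr0.
    rewrite mulrDr mulrA xm2 -(natr1 m.+2) => e.
    by apply/subr0_eq; rewrite -[RHS]e; ring.
  have normx : m.+2%:R * `|x| = m.+3%:R.
    by rewrite -[LHS]ger0_norm ?mulr_ge0// normrM normr_id -normrM xE normrN ger0_norm.
  have x_ge1 : 1 <= `|x|.
    by rewrite -(ler_pM2l (ltr0Sn K m.+1)) normx mulr1 ler_nat.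
  have : m.+3%:R * `|x| ^+ m.+2 = 1.
    by rewrite -normrX -[m.+3%:R]ger0_norm// -normrM xm2 normrN normr1.
  move=> e; have : (1 : K) < 1.
    rewrite -[X in _ < X]e (@lt_le_trans _ _ m.+3%:R)// ?ltr1n//.
    by rewrite ler_peMr// exprn_ege1.
  by rewrite ltxx.
by rewrite coprimep_def => /eqP->.
Qed.

Lemma topological_degree_dmap : has_topological_degree (@dmap K m) m.+3.
Proof.
exists [set z | chi_disc.[z.1, z.2] = 0]; split.
- exists [set chi_disc]; apply/seteqP; split=> z /= => [z0 P ->//|]; exact.
- move=> /seteqP[_ /(_ (0, 1) I)]; exact/eqP/chi_disc_neq0.
- by move=> p /eqP Dp; apply: simple_fiber_card => x; apply: chi_disc_simple.
Qed.

(** * Closedness through continuity of roots *)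

Lemma root_chi_bound p x : root (chi m p) x -> `|x| <= 1 + `|p.1| + `|p.2| *+ 2.
Proof.
rewrite rootE horner_chi => /eqP e.
have [x1|x1] := real_leP (normr_real x) (@real1 K).
  by rewrite (le_trans x1)// -addrA lerDl addr_ge0// mulrn_wge0.
have x_gt0 : 0 < `|x| by rewrite (lt_trans ltr01).
rewrite (@le_trans _ _ (`|p.1| + `|p.2| *+ 2))//; last by rewrite -addrA lerDr.
rewrite -(ler_pM2l (exprn_gt0 m.+2 x_gt0)).
have {}e : x ^+ m.+2 * x = p.1 * x ^+ m.+2 - p.2 * (x + 1).
  by apply/subr0_eq; rewrite -[RHS]e; ring.
rewrite -normrX -normrM e normrX (le_trans (ler_normB _ _))//.
rewrite (normrM p.1) (normrM p.2) normrX mulrDr [X in _ <= X + _]mulrC lerD2l mulrnAr -mulrnAl mulrC.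
rewrite ler_wpM2r//.
rewrite (le_trans (ler_normD _ _))// normr1 mulr2n lerD//.
  by rewrite exprS ler_peMr// exprn_ege1// ltW.
by rewrite exprn_ege1// ltW.
Qed.

Lemma snd_coord_continuous p x :
  (fun w : (K * K) * K => (w.2, snd_coord m w.1 w.2)) @ (p, x) -->
  (x, snd_coord m p x).
Proof.
pose G : {poly K} := \sum_(i < m.+2) 'X^(m.+1 - i) * ((-1) ^+ i)%:P.
have GE y : \sum_(i < m.+2) y ^+ (m.+1 - i) * (-1) ^+ i = G.[y].
  by rewrite horner_sum; apply: eq_bigr => i _; rewrite hornerM hornerXn hornerC.
have cx : (fun w : (K * K) * K => w.2) @ (p, x) --> x by exact: cvg_snd.
have cp : (fun w : (K * K) * K => w.1) @ (p, x) --> p by exact: cvg_fst.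
have c1 : (fun w : (K * K) * K => w.1.1) @ (p, x) --> p.1.
  by apply: (cvg_comp _ _ cp); case: (p) => s t; exact: cvg_fst.
have c2 : (fun w : (K * K) * K => w.1.2) @ (p, x) --> p.2.
  by apply: (cvg_comp _ _ cp); case: (p) => s t; exact: cvg_snd.
apply: (@cvg_pair _ _ _ _ (nbhs x) (nbhs (snd_coord m p x)) _ _ _ _ _ cx).
rewrite /snd_coord GE.
under eq_fun do rewrite GE.
apply: cvgM; first exact: cvg_cst.
apply: cvgB => //; apply: cvgM; first exact: cvgB.
exact: cvg_horner.
Qed.

(** For [p'] within 1 of [p] the roots stay in a disc of radius [M], on which [chi] at [p] and at
    [p'] differ little. *)
Lemma near_root_small p (e : K) : 0 < e ->
  \forall p' \near p, forall x, root (chi m p') x -> `|(chi m p).[x]| < e.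
Proof.
move=> e0; pose M : K := 1 + (`|p.1| + 1) + (`|p.2| + 1) *+ 2.
have M1 : 1 <= M by rewrite /M -addrA lerDl addr_ge0 ?addr_ge0// mulrn_wge0 ?addr_ge0.
have M0 : 0 < M := lt_le_trans ltr01 M1.
have c1 : fst @ p --> p.1 by case: (p) => s t; exact: cvg_fst.
have c2 : snd @ p --> p.2 by case: (p) => s t; exact: cvg_snd.
near=> p' => x rx.
have d1 : `|p.1 - p'.1| < 1.
  by near: p'; apply: (cvgr_dist_lt _ _ c1).
have d2 : `|p.2 - p'.2| < 1.
  by near: p'; apply: (cvgr_dist_lt _ _ c2).
have d1' : `|p.1 - p'.1| < e / 2 / M ^+ m.+2.
  by near: p'; apply: (cvgr_dist_lt _ _ c1); rewrite !divr_gt0// exprn_gt0.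
have d2' : `|p.2 - p'.2| < e / 2 / (M + 1).
  by near: p'; apply: (cvgr_dist_lt _ _ c2); rewrite !divr_gt0// addr_gt0.
have near_norm (a b : K) : `|a - b| < 1 -> `|b| <= `|a| + 1.
  move=> ab; rewrite -[b](subKr a) (le_trans (ler_normB _ _))// lerD2l.
  exact: ltW.
have xM : `|x| <= M.
  apply: (le_trans (root_chi_bound rx)); rewrite /M lerD//.
    by rewrite lerD2l near_norm.
  by rewrite lerMn2r near_norm.
have -> : (chi m p).[x] = (p.2 - p'.2) * (x + 1) - (p.1 - p'.1) * x ^+ m.+2.
  move: rx; rewrite rootE => /eqP r; rewrite -[LHS]subr0 -r !horner_chi; ring.
rewrite (le_lt_trans (ler_normB _ _))// (normrM (p.2 - p'.2)) (normrM (p.1 - p'.1)) normrX.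
have -> : e = e / 2 / (M + 1) * (M + 1) + e / 2 / M ^+ m.+2 * M ^+ m.+2.
  rewrite !divfK -?splitr// ?expf_neq0 ?gt_eqF// addr_gt0//.
apply: ler_ltD.
  apply: ler_pM => //; first exact: ltW.
  rewrite (le_trans (ler_normD _ _))// normr1 lerD2r//.
rewrite (@le_lt_trans _ _ (`|p.1 - p'.1| * M ^+ m.+2))//.
  by rewrite ler_wpM2l// lerXn2r ?nnegrE// ltW.
by rewrite ltr_pM2r// exprn_gt0.
Unshelve. all: by end_near. Qed.

(* Continuity of the roots of [chi], phrased without matching the roots of    *)
(* nearby polynomials.                                                         *)
Lemma near_fiber p (U : set (K * K)) : (forall z, dmap m z = p -> nbhs z U) ->
  \forall p' \near p, forall z, dmap m z = p' -> U z.
Proof.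
move=> pU; have [r Dr] := closed_field_poly_normal (chi m p).
rewrite (monicP (chi_monic _ _)) scale1r in Dr.
(* If the product of the distances to the roots is small, some distance is small; induction on the
   list of roots. *)
have [e e0 nearU] : exists2 e : K, 0 < e & \forall p' \near p, forall x,
    `|\prod_(a <- r) (x - a)| < e -> U (x, snd_coord m p' x).
  have : all (root (chi m p)) r.
    by apply/allP => a; rewrite Dr root_prod_XsubC.
  elim: r {Dr} => [_|a r IH /= /andP[ra /IH[e e0 IHe]]].
    (* The empty product is 1, so the bound 1 makes the claim vacuous. *)
    exists 1 => //; near=> p' => x; rewrite big_nil normr1 ltxx//.
  have : nbhs (p, a) [set w : (K * K) * K | U (w.2, snd_coord m w.1 w.2)].
    apply: (@snd_coord_continuous p a); apply: pU.
    exact/dmap_fiber.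
  case=> -[/= V W] [nV /nbhs_ballP[d /= d0 dW]] VW.
  exists (d * e); first by rewrite mulr_gt0.
  near=> p' => x; rewrite big_cons normrM => small.
  have [xa|xa] := real_ltP (normr_real (x - a)) (gtr0_real d0).
    apply: (VW (p', x)); split=> /=; first by near: p'.
    by apply: dW; rewrite -ball_normE /= distrC.
  have : `|\prod_(j <- r) (x - j)| < e.
    rewrite -(ltr_pM2l d0) (le_lt_trans _ small)// ler_wpM2r//.
  by move: x {xa small}; near: p'.
have := near_root_small p e0.
apply: filterS2 nearU => p' pU' small z /dmap_fiber[rz zE].
rewrite [z]surjective_pairing zE; apply: pU'.
have := small _ rz; rewrite Dr horner_prod.
by under eq_bigr do rewrite hornerXsubC.
Unshelve. all: by end_near. Qed.

Lemma closed_dmap : closed_map (@dmap K m).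
Proof.
move=> A cA; rewrite -openC openE => p Ap.
have /near_fiber : forall z, dmap m z = p -> nbhs z (~` A).
  move=> z zp; apply: open_nbhs_nbhs; split; first by rewrite openC.
  by move=> Az; apply: Ap; exists z.
by apply: filterS => p' H [z Az zp']; apply: (H z).
Qed.

Lemma proper_dmap : proper_polynomial_map (@dmap K m).
Proof.
split; [exact: polynomial_dmap|exact: dominant_dmap|exact: closed_dmap|].
exact: dmap_fiber_compact.
Qed.

End Proper.

Local Close Scope classical_set_scope.

(** * Non-equivalence *)

Section NonEquivalence.
Variable K : numClosedFieldType.
Implicit Types (u v A B X Y : {poly {poly K}}) (f : K * K -> K * K).

Lemma polynomial_mapP f : polynomial_map f ->
  exists A B, forall x y, f (x, y) = (A.[y, x], B.[y, x]).
Proof.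
case=> P [Q fPQ]; exists (swapXY P), (swapXY Q) => x y.
by rewrite !horner2_swapXY fPQ.
Qed.

Lemma jac_variables : jac 'Y 'X = 1 :> {poly {poly K}}.
Proof. by rewrite /jac dXC !derivX dX_X polyC1 mulr0 subr0 mulr1. Qed.

(** The chain rule applied to g o f = id exhibits an inverse of the Jacobian. *)
Lemma automorphism_jac f : polynomial_automorphism f -> exists A B,
  (forall x y, f (x, y) = (A.[y, x], B.[y, x])) /\ jac A B \is a GRing.unit.
Proof.
case=> /polynomial_mapP[A [B fE]] [g [/polynomial_mapP[A' [B' gE]] fK _]].
exists A, B; split=> //.
have sE x y : ((subst A B A').[y, x], (subst A B B').[y, x]) = (x, y).
  by rewrite !horner_subst -gE -fE fK.
have sA : subst A B A' = 'Y.
  by apply: horner2_inj => x y; case: (sE x y) => -> _; rewrite !hornerE.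
have sB : subst A B B' = 'X.
  by apply: horner2_inj => x y; case: (sE x y) => _ ->; rewrite !hornerE.
have := jac_subst A B A' B'; rewrite sA sB jac_variables => e.
by apply/unitrPr; exists (subst A B (jac A' B')); rewrite mulrC.
Qed.

Lemma horner2_unit u x y : u \is a GRing.unit -> u.[y, x] != 0.
Proof.
case/unitrPr => v uv; apply/eqP => u0.
have : (u * v).[y, x] = 1 by rewrite uv !hornerE.
by rewrite !hornerM u0 mul0r => /esym/eqP; rewrite oner_eq0.
Qed.

Lemma jac_dmap m X Y : jac (X + Y + X * Y) (X ^+ m.+2 * Y) =
  X ^+ m.+1 * (X - m.+2%:R * Y - m.+1%:R * (X * Y)) * jac X Y.
Proof.
have dXe n : dX (X ^+ n.+1) = n.+1%:R * X ^+ n * dX X.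
  elim: n => [|n IH]; first by rewrite expr1 expr0; ring.
  by rewrite exprS dXM IH -(natr1 n.+1) (exprS X n); ring.
have dYe : (X ^+ m.+2)^`() = m.+2%:R * X ^+ m.+1 * X^`().
  by rewrite deriv_exp -mulr_natl; ring.
move: (X ^+ m.+2) (dXe m.+1) dYe (exprS X m.+1) => U dXU dYU UE.
rewrite /jac !raddfD /= !dXM !derivM dXU dYU UE -(natr1 m.+1); ring.
Qed.

Lemma dmap_not_equivalent m (Q0 : {poly {poly K}}) :
  ~ equivalent_maps (@dmap K m) (fun z => (z.1, Q0.[z.1, z.2])).
Proof.
case=> Phi1 [Phi2 [A1 [P2 [Psi2 [PP2 Phi2K Psi2K]]] E]].
have A2 : polynomial_automorphism Psi2 by split=> //; exists Phi2.
have [X [Y [Phi1E jXY]]] := automorphism_jac A1.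
have [S [T [Psi2E jST]]] := automorphism_jac A2.
case: A1 => _ [Psi1 [_ Phi1K Psi1K]].
pose Q := swapXY Q0.
have rel x y : dmap m (Phi1 (x, y)) = Psi2 (x, Q.[y, x]).
  apply: (can_inj Phi2K); rewrite Psi2K.
  by have := congr1 (@^~ (x, y)) E; rewrite /= -horner2_swapXY => <-.
have relE x y : (X + Y + X * Y).[y, x] = (subst 'Y Q S).[y, x] /\
                (X ^+ m.+2 * Y).[y, x] = (subst 'Y Q T).[y, x].
  have := rel x y; rewrite Phi1E Psi2E /dmap !horner_subst => -[e1 e2].
  by rewrite !(horner_exp, hornerD, hornerM) e1 e2 !hornerE.
pose k := X - m.+2%:R * Y - m.+1%:R * (X * Y).
have J : X ^+ m.+1 * k * jac X Y = subst 'Y Q (jac S T) * Q^`().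
  rewrite -jac_dmap (horner2_inj (fun x y => (relE x y).1)).
  rewrite (horner2_inj (fun x y => (relE x y).2)) jac_subst; congr (_ * _).
  by rewrite /jac dXC derivX polyC1 mul1r derivC mul0r subr0.
have uST : subst 'Y Q (jac S T) \is a GRing.unit.
  have /unitrPr[v jv] := jST; apply/unitrPr; exists (subst 'Y Q v).
  by rewrite -rmorphM jv rmorph1.
have kE x y : k.[y, x] = crit m (Phi1 (x, y)).
  by rewrite Phi1E /crit /k !(hornerE, hornerMn).
(* The equivalence restricted to the line x = a. *)
have sizeQ a : size (map_poly (horner_eval a) Q) = m.+4.
  apply: (@size_of_fibers _ m _ (fun b => Psi2 (a, b)) (fun y => Phi1 (a, y))).
  - by move=> y; rewrite horner_fiber rel.
  - by move=> y y' /(can_inj Phi1K)[].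
  - move=> b z; rewrite -[z]Psi1K; case: (Psi1 z) => x y; rewrite rel.
    by move=> /(can_inj Psi2K)[-> <-]; exists y; rewrite // horner_fiber.
  - move=> y; rewrite -kE Phi1E /= => J0.
    rewrite deriv_map horner_fiber; apply/eqP.
    have := congr1 (fun u => u.[y, a]) J.
    rewrite /= !(horner_exp, hornerM) J0 mul0r => /esym/eqP.
    by rewrite mulf_eq0 (negPf (horner2_unit _ _ uST)).
have [sQ lQ] := constant_fiber_size sizeQ.
have natP n : n.+1%:R != 0 :> {poly K}.
  by rewrite -polyC_natr polyC_eq0 pnatr_eq0.
have sQ' : size Q^`() = m.+3 by rewrite size_deriv_pchar0 ?sQ.
have lQ' : lead_coef Q^`() \is a GRing.unit.
  rewrite lead_coefE sQ' coef_deriv -mulr_natr unitrM.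
  by rewrite lead_coefE sQ in lQ; rewrite lQ -polyC_natr rmorph_unit// unitfE pnatr_eq0.
have unit_size u : u \is a GRing.unit -> size u = 1 /\ lead_coef u \is a GRing.unit.
  by rewrite poly_unitE => /andP[/eqP su]; rewrite lead_coefE su.
have [s1 l1] := unit_size _ jXY; have [s2 l2] := unit_size _ uST.
have : lead_coef (X ^+ m.+1 * k * jac X Y) \is a GRing.unit.
  by rewrite J lead_coefM unitrM l2.
rewrite !lead_coefM !unitrM lead_coef_exp unitrX_pos// => /andP[/andP[lX lk] _].
have X0 : X != 0 by rewrite -lead_coef_eq0; apply: contraTneq lX => ->; rewrite unitr0.
have k0 : k != 0 by rewrite -lead_coef_eq0; apply: contraTneq lk => ->; rewrite unitr0.
have not_const u : lead_coef u \is a GRing.unit -> (exists x y, u.[y, x] = 0) ->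
    (1 < size u)%N.
  move=> lu [x [y u0]]; rewrite ltnNge; apply/negP => /size1_polyC uC.
  have : u.[y, x] != 0.
    by apply: horner2_unit; move: lu; rewrite uC lead_coefC => lu; rewrite rmorph_unit.
  by rewrite u0 eqxx.
(* Both [X] and [k] vanish at the preimage of the origin, so neither is constant in y. *)
have [[x0 y0] Phi0] : exists z, Phi1 z = 0 by exists (Psi1 0); rewrite Psi1K.
have sX : (1 < size X)%N.
  by apply: not_const => //; exists x0, y0; have := Phi0; rewrite Phi1E => -[].
have sk : (1 < size k)%N.
  apply: not_const => //; exists x0, y0; rewrite kE Phi0 /crit /=; ring.
(* Degrees in y: (m+1) deg X + deg k = m + 2 with both degrees positive. *)
have sk2 : size k = 2.
  have := congr1 (fun u : {poly {poly K}} => size u) J.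
  rewrite /= size_mul ?mulf_neq0 ?expf_neq0//; last first.
    by rewrite -size_poly_eq0 s1.
  rewrite [in RHS]size_mul -?size_poly_eq0 ?s2 ?sQ'// s1 size_mul ?expf_neq0//.
  have := size_exp X m.+1.
  have : (m.+1 <= (size X).-1 * m.+1)%N by rewrite leq_pmull// -subn1 subn_gt0.
  by move: sk; move: (_ * m.+1)%N (size (X ^+ _)) (size k) => i j l; clear; lia.
(* The root in y of the linear polynomial [k], a polynomial in x since the leading coefficient is a
   unit. *)
pose h : {poly K} := - k`_0 * (lead_coef k)^-1.
have kh : k.[h] = 0.
  rewrite horner_coef sk2 !big_ord_recl big_ord0 /= /bump /= expr0 expr1 addr0.
  by rewrite /h lead_coefE sk2 in lk *; rewrite mulr1 mulrCA divrr// mulr1 subrr.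
pose Xh := X.[h]; pose Yh := Y.[h].
have e : Xh - m.+2%:R * Yh - m.+1%:R * (Xh * Yh) = 0.
  by rewrite -kh /k !(hornerD, hornerN, hornerM, hornerMn, hornerC).
(* The hyperbola equation: a factor of a nonzero constant is a unit of K[x], hence constant. *)
have u1 : m.+2%:R + m.+1%:R * Xh \is a GRing.unit.
  have : (m.+2%:R : {poly K}) \is a GRing.unit.
    by rewrite -polyC_natr rmorph_unit// unitfE pnatr_eq0.
  suff {1}<- : (m.+2%:R + m.+1%:R * Xh) * (1 - m.+1%:R * Yh) = m.+2%:R.
    by rewrite unitrM => /andP[].
  by rewrite -[RHS]addr0 -[in RHS](mulr0 m.+1%:R) -[in RHS]e; ring.
have constX : (size Xh <= 1)%N.
  move: u1; rewrite poly_unitE => /andP[/eqP su _].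
  have -> : Xh = (m.+1%:R^-1)%:P * ((m.+2%:R + m.+1%:R * Xh) - m.+2%:R).
    rewrite addrC addKr -polyC_natr mulrA -polyCM mulVf ?mul1r// pnatr_eq0//.
  rewrite mul_polyC (leq_trans (size_scale_leq _ _))//.
  rewrite (leq_trans (size_polyD _ _))// su size_polyN -polyC_natr geq_max/=.
  exact: size_polyC_leq1.
have constY : (size Yh <= 1)%N.
  have eY : Yh * (m.+2%:R + m.+1%:R * Xh) = Xh.
    by apply/esym/subr0_eq; rewrite -[RHS]e; ring.
  have -> : Yh = Xh / (m.+2%:R + m.+1%:R * Xh) by apply: (canRL (mulrK u1)).
  have := u1; rewrite -unitrV poly_unitE => /andP[/eqP su _].
  by rewrite (leq_trans (size_polyMleq _ _))// su addn1.
have graph a : Phi1 (a, h.[a]) = (Xh.[a], Yh.[a]).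
  by rewrite Phi1E /Xh /Yh -!horner_fiber -![h.[a]]/(horner_eval a h) !horner_map.
(* [Phi1] would take the same value at the points of the graph over 0 and 1. *)
have := graph 0; have := graph 1.
rewrite (size1_polyC constX) (size1_polyC constY) !hornerC => <-.
by move=> /(can_inj Phi1K)[/esym/eqP]; rewrite oner_eq0.
Qed.

End NonEquivalence.

Theorem theoremA (R : realType) (d : nat) (hd : (3 <= d)%N) :
  exists f : R[i] * R[i] -> R[i] * R[i],
    [/\ proper_polynomial_map f,
        has_topological_degree f d &
        forall Q : {poly {poly R[i]}},
          ~ equivalent_maps f (fun z => (z.1, Q.[z.1, z.2]))].
Proof.
move: hd; case: d => [|[|[|m]]] // _; exists (dmap m).
split; [exact: proper_dmap|exact: topological_degree_dmap|].
exact: dmap_not_equivalent.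
Qed.
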